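(* Let $\mathbb{X}$ be a real Banach space and $\mathbb{Y}$ a real normed space. Let $T \in B(\mathbb{X},\mathbb{Y})$ be such that $M_T = D \cup (-D)$, where $D$ is a non-empty compact connected subset of $S_{\mathbb{X}}$. Suppose that $\sup\{\|Tx\| : x \in C\} < \|T\|$ for every closed subset $C$ of $S_{\mathbb{X}}$ with $d(M_T, C) > 0$. Then for any $A \in B(\mathbb{X},\mathbb{Y})$, $T \perp_B A$ if and only if there exists $z \in M_T$ such that $Tz \perp_B Az$.
   Context: $S_{\mathbb{X}} = \{x \in \mathbb{X} : \|x\| = 1\}$ is the unit sphere (with the norm topology). $B(\mathbb{X},\mathbb{Y})$ is the space of bounded linear operators from $\mathbb{X}$ to $\mathbb{Y}$ with the operator norm. $M_T = \{x \in S_{\mathbb{X}} : \|Tx\| = \|T\|\}$. For sets $E, C$, $d(E,C) = \inf\{\|x-y\| : x \in E, y \in C\}$. Birkhoff-James orthogonality: for elements $u,v$ of a real normed space, $u \perp_B v$ means $\|u\| \le \|u + \lambda v\|$ for all $\lambda \in \mathbb{R}$; for operators it is taken with respect to the operator norm. *)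

(* Defs.v *)
From HB Require Import structures.
From mathcomp Require Import all_boot all_order all_algebra.
From mathcomp Require Import all_classical all_reals all_analysis.

Set Implicit Arguments.
Unset Strict Implicit.
Unset Printing Implicit Defensive.

Import Order.TTheory GRing.Theory Num.Theory.
Import numFieldNormedType.Exports.

Local Open Scope classical_set_scope.
Local Open Scope ring_scope.

Definition unit_sphere (R : realType) (X : normedModType R) : set X :=
  [set x | `|x| = 1].
Arguments unit_sphere {R} X.

(* The real-valued sup is the genuine supremum only when f is bounded on the
   unit ball; this holds for every bounded linear f. *)
Definition opnorm (R : realType) (X Y : normedModType R) (f : X -> Y) : R :=
  sup [set `|f x| | x in [set x : X | `|x| <= 1]].

Definition norm_attainment (R : realType) (X Y : normedModType R)
    (f : X -> Y) : set X :=
  [set x | unit_sphere X x /\ `|f x| = opnorm f].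

(* Extended-real valued, so that the distance to the empty set is +oo. *)
Definition set_dist (R : realType) (X : normedModType R) (E C : set X) :
    \bar R :=
  ereal_inf [set (`|x - y|)%:E | x in E & y in C].

(* The norm N is a parameter because bounded operators are handled below as
   elements of the pointwise vector space X -> Y, on which the operator norm is
   not a registered norm structure. *)
Definition birkhoff_orth (R : realType) (V : lmodType R) (N : V -> R)
    (u v : V) : Prop :=
  forall lambda : R, N u <= N (u + lambda *: v).

Definition vec_birkhoff_orth (R : realType) (V : normedModType R)
    (u v : V) : Prop :=
  birkhoff_orth (fun w : V => `|w|) u v.

Definition op_birkhoff_orth (R : realType) (X Y : normedModType R)
    (f g : X -> Y) : Prop :=
  birkhoff_orth (@opnorm R X Y) f g.

(* Main.v *)
(* If z attains the norm of T and Tz is orthogonal to Az, then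
   ||T|| = ||Tz|| <= ||Tz + l Az|| <= ||T + l A||.  Conversely, let P and Q be the
   sets of points x with ||Tx + l Ax|| >= ||Tx|| for all l >= 0, resp. all l <= 0.
   They are closed, and they cover X because l |-> ||Tx + l Ax|| is convex, so by
   connectedness of D it suffices that both of them meet D.  If P misses D, then
   convexity and compactness give r > 0 such that
   ||Tw + l Aw|| <= ||T|| - l r for 0 <= l <= r and every unit vector w within r
   of M_T; away from M_T the gap hypothesis bounds ||Tw|| by some s < ||T||.
   Hence ||T + l A|| < ||T|| for small l > 0, contradicting the orthogonality of
   T and A.  The case of Q is that of P for -A. *)

Require Import Defs.
From HB Require Import structures.
From mathcomp Require Import all_boot all_order all_algebra.
From mathcomp Require Import all_classical all_reals all_analysis.
From mathcomp Require Import lra.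

Set Implicit Arguments.
Unset Strict Implicit.
Unset Printing Implicit Defensive.

Import Order.TTheory GRing.Theory Num.Theory.
Import numFieldNormedType.Exports.

Local Open Scope classical_set_scope.
Local Open Scope ring_scope.

(** One half of orthogonality; replacing [v] by [- v] gives the other half, so each lemma serves
    both signs. *)
Definition right_birkhoff_orth (R : realType) (V : normedModType R)
    (u v : V) : Prop :=
  forall lambda : R, 0 <= lambda -> `|u| <= `|u + lambda *: v|.

Section RightBirkhoffOrth.
Variables (R : realType) (V : normedModType R).
Implicit Types (u v : V) (l m : R).

(** [u + l *: v] divides the segment from [u] to [u + m *: v] in the ratio [l : m - l]. Multiplying
    by [m] avoids a division. *)
Lemma norm_addZ_convex u v l m : 0 <= l -> l <= m ->
  m * `|u + l *: v| <= (m - l) * `|u| + l * `|u + m *: v|.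
Proof.
move=> l0 lm; have m0 : 0 <= m by exact: le_trans lm.
have ml0 : 0 <= m - l by rewrite subr_ge0.
have nZ k w : 0 <= k -> k * `|w| = `|k *: w|.
  by move=> k0; rewrite normrZ ger0_norm.
rewrite !nZ//; suff -> : m *: (u + l *: v) = (m - l) *: u + l *: (u + m *: v).
  exact: ler_normD.
rewrite !scalerDr scalerBl !scalerA (mulrC m l) addrA.
by rewrite subrK.
Qed.

(** If both failed, at [l] and [m], then [u] would be a convex combination of [u + l *: v] and
    [u - m *: v], both of norm less than that of [u]. *)
Lemma right_birkhoff_orth_or u v :
  right_birkhoff_orth u v \/ right_birkhoff_orth u (- v).
Proof.
apply: contrapT => /not_orP[/existsNP[l /not_implyP[l0 /negP]]].
rewrite -ltNge => ul /existsNP[m /not_implyP[m0 /negP]].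
rewrite -ltNge scalerN => um.
have l_gt0 : 0 < l.
  rewrite lt_def l0 andbT; apply: contraTN ul => /eqP->.
  by rewrite scale0r addr0 ltxx.
have lm_gt0 : 0 < l + m by rewrite ltr_wpDr.
have : `|(l + m) *: u| <= m * `|u + l *: v| + l * `|u - m *: v|.
  have nZ k w : 0 <= k -> k * `|w| = `|k *: w|.
    by move=> k0; rewrite normrZ ger0_norm.
  rewrite !nZ//; suff -> : (l + m) *: u = m *: (u + l *: v) + l *: (u - m *: v).
    exact: ler_normD.
  rewrite !scalerDr scalerN !scalerA (mulrC m l) scalerDl.
  by rewrite addrACA subrr addr0 addrC.
rewrite normrZ (gtr0_norm lm_gt0) leNgt => /negP; apply.
rewrite mulrDl [ltRHS]addrC ler_ltD//; first by rewrite ler_wpM2l// ltW.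
by rewrite ltr_pM2l.
Qed.

Lemma right_birkhoff_orth_vec u v :
  right_birkhoff_orth u v -> right_birkhoff_orth u (- v) ->
  vec_birkhoff_orth u v.
Proof.
move=> uv uNv l; have [l0|/ltW l0] := leP 0 l; first exact: uv.
by have := uNv (- l); rewrite oppr_ge0 scalerN scaleNr opprK; apply.
Qed.

End RightBirkhoffOrth.

Section OperatorNorm.
Variables (R : realType) (X Y : normedModType R).
Implicit Types (T A : {linear X -> Y}).

Lemma closed_right_birkhoff_orth T A : continuous T -> continuous A ->
  closed [set x | right_birkhoff_orth (T x) (A x)].
Proof.
move=> cT cA.
have -> : [set x | right_birkhoff_orth (T x) (A x)] =
    \bigcap_(l in [set l : R | 0 <= l])
      [set x | 0 <= `|T x + l *: A x| - `|T x|].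
  apply/seteqP; split => x /= xP l /= l0; last by rewrite -subr_ge0 xP.
  by rewrite subr_ge0 xP.
apply: closed_bigI => l _.
apply: (@preimage_closed _ _ (fun x => `|T x + l *: A x| - `|T x|)
  [set y | 0 <= y]); last exact: closed_ge.
move=> x _; apply: cvgB; apply: cvg_norm; last exact: cT.
by apply: cvgD; [exact: cT|apply: cvgZl_tmp; exact: cA].
Qed.

Lemma bounded_linear_bound T : bounded_near T (nbhs (0 : X)) ->
  exists2 M, 0 < M & forall x, `|T x| <= M * `|x|.
Proof. by move=> /linear_boundedP/pinfty_ex_gt0. Qed.

(** The bound [M] is what makes [sup] a true supremum here. *)
Lemma opnorm_ub (f : X -> Y) (M : R) :
  (forall x, `|x| <= 1 -> `|f x| <= M) ->
  forall x, `|x| <= 1 -> `|f x| <= opnorm f.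
Proof.
move=> fM x x1; apply: ub_le_sup; last by exists x.
by exists M => _ [y y1 <-]; exact: fM.
Qed.

Lemma opnorm_le (f : X -> Y) (M : R) :
  (forall x, `|x| <= 1 -> `|f x| <= M) -> opnorm f <= M.
Proof.
move=> fM; apply: ge_sup; first by exists `|f 0|, 0 => //=; rewrite normr0.
by move=> _ [y y1 <-]; exact: fM.
Qed.

(** By homogeneity. [opnorm] ranges over the unit ball, whereas the gap hypothesis concerns the
    sphere. *)
Lemma norm_addZ_le_ball T (l : R) A (M : R) : 0 <= M ->
  (forall x, `|x| = 1 -> `|T x + l *: A x| <= M) ->
  forall x, `|x| <= 1 -> `|T x + l *: A x| <= M.
Proof.
move=> M0 TM x x1; have [->|x0] := eqVneq x 0.
  by rewrite !raddf0 addr0 normr0.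
have nx : `|x| != 0 by rewrite normr_eq0.
have -> : T x + l *: A x =
    `|x| *: (T (`|x|^-1 *: x) + l *: A (`|x|^-1 *: x)).
  rewrite !linearZ /= scalerDr !scalerA mulfV// scale1r.
  by rewrite mulVKf.
rewrite normrZ normr_id; apply: le_trans (_ : `|x| * M <= _).
  by rewrite ler_wpM2l// TM// normrZ normfV normr_id mulVf.
by rewrite ler_piMl.
Qed.

Lemma uniform_norm_descent (D : set X) T A (N : R) :
  compact D -> continuous T -> continuous A ->
  (forall x, `|x| <= 1 -> `|T x| <= N) ->
  (forall x, D x -> exists2 m, 0 < m & `|T x + m *: A x| < N) ->
  exists2 r, 0 < r & forall y, D y -> forall w, `|w| <= 1 -> `|y - w| < r ->
    forall l, 0 <= l -> l <= r -> `|T w + l *: A w| <= N - l * r.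
Proof.
move=> cD cT cA TN Tm.
pose P (r : R) y := forall w : X, `|w| <= 1 -> `|y - w| < r ->
  forall l, 0 <= l -> l <= r -> `|T w + l *: A w| <= N - l * r.
(* Compactness as near covering: it is enough to get [P r y] for [y] near a given point of [D] and
   small [r > 0]. *)
suff : \forall r \near 0^'+, D `<=` P r.
  move=> DP; near (0 : R)^'+ => r.
  by exists r; near: r => //; exact: nbhs_right_gt.
move/compact_near_coveringP : cD; apply => x Dx.
have [m m_gt0 xm] := Tm _ Dx.
(* Half of the gap at [x]; the other half absorbs the variation of the norm for [w] near [x]. *)
pose e := (N - `|T x + m *: A x|) / 2.
have e0 : 0 < e by rewrite divr_gt0// subr_gt0.
have cg : continuous (fun w => `|T w + m *: A w|).
  move=> w; apply: cvg_norm; apply: cvgD; first exact: cT.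
  by apply: cvgZl_tmp; exact: cA.
have /cvgrPdist_lt/(_ _ e0)/nbhs_normP[d /= d0 dP] := cg x.
have gN w : `|x - w| < d -> `|T w + m *: A w| <= N - e.
  by move=> /dP /=; rewrite ltr_norml => /andP[+ _]; rewrite /e; lra.
near=> y r => /= w w1 yw l l0 lr.
have xw : `|x - w| < d.
  rewrite -(subrK y x) -addrA; apply: le_lt_trans (ler_normD _ _) _.
  rewrite [d]splitr ltrD//.
    near: y; apply/nbhs_normP; exists (d / 2) => //=; exact: divr_gt0.
  apply: lt_trans yw _; near: r; apply: nbhs_right_lt; exact: divr_gt0.
have lm : l <= m by apply: le_trans lr _; near: r; exact: nbhs_right_le.
have re : r * m <= e.
  rewrite -ler_pdivlMr//; near: r; apply: nbhs_right_le; exact: divr_gt0.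
have ml0 : 0 <= m - l by rewrite subr_ge0.
(* After multiplication by [m], convexity bounds the left side by [(m - l) * N + l * (N - e) = m * N
   - l * e], and [r * m <= e]. *)
rewrite -(ler_pM2l m_gt0); apply: le_trans (norm_addZ_convex _ _ l0 lm) _.
have := ler_wpM2l ml0 (TN _ w1); have := ler_wpM2l l0 (gN _ xw).
have := ler_wpM2l l0 re; nra.
Unshelve. all: by end_near.
Qed.

(** Assuming only [0 <= l] lets this apply to both [A] and [\- A], which yields points of [D] in P
    and in Q. *)
Lemma exists_right_birkhoff_orth T A (D : set X) :
  bounded_near T (nbhs (0 : X)) -> bounded_near A (nbhs (0 : X)) ->
  compact D -> D !=set0 ->
  norm_attainment T = D `|` [set - x | x in D] ->
  (forall C : set X, C `<=` unit_sphere X -> closed C ->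
    (0 < set_dist (norm_attainment T) C)%E ->
    (ereal_sup [set (`|T x|)%:E | x in C] < (opnorm T)%:E)%E) ->
  (forall l, 0 <= l -> opnorm T <= opnorm (fun x => T x + l *: A x)) ->
  exists2 z, D z & right_birkhoff_orth (T z) (A z).
Proof.
move=> bT bA cD [x0 Dx0] MT gap TA; apply: contrapT => noz.
have [MA MA0 AM] := bounded_linear_bound bA.
have [MB MB0 TM] := bounded_linear_bound bT.
have cT := bounded_linear_continuous bT.
have cA := bounded_linear_continuous bA.
set N := opnorm T in gap TA *.
have TN x : `|x| <= 1 -> `|T x| <= N.
  apply: (@opnorm_ub T MB) => y y1; apply: le_trans (TM y) _.
  by rewrite ler_piMr// ltW.
have Tm x : D x -> exists2 m, 0 < m & `|T x + m *: A x| < N.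
  move=> Dx; have [_ Tx] : norm_attainment T x by rewrite MT; left.
  apply: contrapT => nom; apply: noz; exists x => // m.
  rewrite le_eqVlt => /predU1P[<-|m0]; first by rewrite scale0r addr0.
  rewrite leNgt; apply/negP => xm; apply: nom.
  by exists m => //; rewrite /N -Tx.
have N0 : 0 < N by have [m _] := Tm _ Dx0; exact: le_lt_trans.
have [r r0 rP] := uniform_norm_descent cD cT cA TN Tm.
(* On C the gap hypothesis keeps T away from N; on the rest of the sphere, which
   is within r of M_T, the uniform descent applies. *)
pose C := unit_sphere X `&`
  \bigcap_(y in norm_attainment T) [set w | r <= `|y - w|].
have cC : closed C.
  apply: closedI.
    apply: (@preimage_closed _ _ (fun x : X => `|x|) [set 1]).
      by move=> x _; exact: norm_continuous.
    exact: closed_eq.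
  apply: closed_bigI => y _.
  apply: (@preimage_closed _ _ (fun w => `|y - w|) [set t | r <= t]).
    by move=> w _; apply: cvg_norm; apply: cvgB; [exact: cvg_cst|exact: cvg_id].
  exact: closed_ge.
have dC : (0 < set_dist (norm_attainment T) C)%E.
  apply: (@lt_le_trans _ _ r%:E); first by rewrite lte_fin.
  apply: le_ereal_inf_tmp => _ [y My [w [_ Cw] <-]].
  by rewrite lee_fin; exact: Cw.
have [s [s0 sN sC]] :
    exists s, [/\ 0 <= s, s < N & forall w, C w -> `|T w| <= s].
  have := gap C (@subIsetl _ _ _) cC dC.
  set S := ereal_sup _ => SN.
  have CS w : C w -> (`|T w|%:E <= S)%E.
    by move=> Cw; apply: ereal_sup_ubound; exists w.
  (* If [S] is [-oo], then [C] is empty and [s = 0] will do. *)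
  case: S SN CS => [s|//|] SN CS.
    exists (Num.max 0 s); split; first by rewrite le_max lexx.
      by rewrite gt_max N0 -lte_fin.
    by move=> w /CS; rewrite lee_fin le_max => ->; rewrite orbT.
  exists 0; split => // w /CS; by rewrite leNgt ltNyr.
(* [l <= r] is for the descent near M_T; the other bound gives [s + l * MA <= (N + s) / 2 < N] on
   [C]. *)
pose l := Num.min r ((N - s) / 2 / MA).
have l0 : 0 < l by rewrite lt_min r0 !divr_gt0// subr_gt0.
have lr : l <= r by rewrite ge_min lexx.
have lMA : l * MA <= (N - s) / 2.
  by rewrite -ler_pdivlMr// ge_min lexx orbT.
have := TA _ (ltW l0); apply/negP; rewrite -ltNge.
apply: (@le_lt_trans _ _ (Num.max (N - l * r) (s + l * MA))); last first.
  by rewrite gt_max ltrBlDr ltrDl mulr_gt0//=; lra.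
apply: opnorm_le; apply: norm_addZ_le_ball.
  by rewrite le_max; apply/orP; right; rewrite addr_ge0// mulr_ge0 ?ltW.
move=> w w1; rewrite le_max.
have [Cw|/not_andP[//|/existsNP[y /not_implyP[My /negP]]]] := pselect (C w).
  apply/orP; right; apply: le_trans (ler_normD _ _) _.
  rewrite lerD ?sC// normrZ gtr0_norm// ler_wpM2l ?(ltW l0)//.
  by apply: le_trans (AM _) _; rewrite w1 mulr1.
rewrite -ltNge => yw; apply/orP; left.
move: My; rewrite MT => -[Dy|[y' Dy' yE]].
  by apply: (rP y) => //; [rewrite w1|exact: ltW].
(* Here [y = - y'], so the descent is applied at [- w], where the norm is the same. *)
rewrite -normrN opprD -scalerN -!raddfN.
apply: (rP y') => //; [by rewrite normrN w1| |exact: ltW].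
by rewrite -normrN opprD opprK yE.
Qed.

End OperatorNorm.

Theorem theorem2p2 (R : realType) (X : completeNormedModType R)
    (Y : normedModType R) (T : {linear X -> Y})
    (T_bounded : bounded_near T (nbhs (0 : X)))
    (D : set X) (D_sphere : D `<=` unit_sphere X) (D_nonempty : D !=set0)
    (D_compact : compact D) (D_connected : connected D)
    (MT_eq : norm_attainment T = D `|` [set - x | x in D])
    (T_gap : forall C : set X, C `<=` unit_sphere X -> closed C ->
      (0 < set_dist (norm_attainment T) C)%E ->
      (ereal_sup [set (`|T x|)%:E | x in C] < (opnorm T)%:E)%E)
    (A : {linear X -> Y}) (A_bounded : bounded_near A (nbhs (0 : X))) :
  op_birkhoff_orth T A <->
  exists z : X, norm_attainment T z /\ vec_birkhoff_orth (T z) (A z).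
Proof.
have [MA MA0 AM] := bounded_linear_bound A_bounded.
have [MT MT0 TM] := bounded_linear_bound T_bounded.
split; last first.
  move=> [z [[z1 Tz] zTA]] l; rewrite -Tz; apply: le_trans (zTA l) _.
  apply: (@opnorm_ub _ _ _ (fun x => T x + l *: A x) (MT + `|l| * MA)).
    move=> x x1; apply: le_trans (ler_normD _ _) _; rewrite lerD//.
      by apply: le_trans (TM x) _; rewrite ler_piMr// ltW.
    rewrite normrZ ler_wpM2l//.
    by apply: le_trans (AM x) _; rewrite ler_piMr// ltW.
  by rewrite z1.
move=> TA.
have NA_bounded : bounded_near (\- A) (nbhs (0 : X)).
  apply/linear_boundedP; move/linear_boundedP : A_bounded.
  by apply: filterS => r Ar x; rewrite /= normrN.
have cT := bounded_linear_continuous T_bounded.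
have cA := bounded_linear_continuous A_bounded.
have cNA := bounded_linear_continuous NA_bounded.
have [p Dp pP] : exists2 z, D z & right_birkhoff_orth (T z) (A z).
  apply: exists_right_birkhoff_orth => // l _; exact: TA.
have [q Dq qP] : exists2 z, D z & right_birkhoff_orth (T z) (- A z).
  apply: (@exists_right_birkhoff_orth _ _ _ T (\- A)) => // l _.
  have := TA (- l); congr (_ <= opnorm _).
  by apply/funext => x /=; rewrite scalerN -scaleNr.
pose P := [set x | right_birkhoff_orth (T x) (A x)].
pose Q := [set x | right_birkhoff_orth (T x) (- A x)].
have cP : closed P by exact: closed_right_birkhoff_orth.
have cQ : closed Q by exact: (closed_right_birkhoff_orth cT cNA).
have [z [Dz Pz Qz]] : exists z, [/\ D z, P z & Q z].
  apply: contrapT => noz.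
  have DP : D `&` P = D.
    apply: D_connected; first by exists p.
    - exists (~` Q); first exact: closed_openC.
      apply/seteqP; split => x [Dx xP]; split=> //.
        by move=> Qx; apply: noz; exists x.
      by case: (right_birkhoff_orth_or (T x) (A x)).
    - by exists P.
  have [_ Pq] : (D `&` P) q by rewrite DP.
  by apply: noz; exists q.
exists z; split; first by rewrite MT_eq; left.
exact: right_birkhoff_orth_vec.
Qed.
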